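(* Let $\mathcal{L}$ be a finite trim lattice of length $n$ with left modular labelling $\gamma$ (defined in the context). Then: (a) $\gamma$ is descriptive: every $x\in\mathcal{L}$ is determined by $\mathrm{D}^\gamma(x)$, every $x\in\mathcal{L}$ is determined by $\mathrm{U}^\gamma(x)$, and $\{\mathrm{D}^\gamma(x): x\in\mathcal{L}\}=\{\mathrm{U}^\gamma(x): x\in\mathcal{L}\}$. Hence rowmotion $\mathrm{row}^\gamma:\mathcal{L}\to\mathcal{L}$, sending $x$ to the unique $y\in\mathcal{L}$ with $\mathrm{U}^\gamma(y)=\mathrm{D}^\gamma(x)$, is well defined. (b) Rowmotion can be computed in slow motion: for every linear extension $(l_1,l_2,\dots,l_n)$ of the Galois poset $P(\mathcal{L})$, \[\mathrm{row}^\gamma=\mathrm{flip}^\gamma_{l_n}\circ\cdots\circ\mathrm{flip}^\gamma_{l_2}\circ\mathrm{flip}^\gamma_{l_1},\] i.e. one applies first the flip at $l_1$, then at $l_2$, and so on.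
   Context: All lattices are finite. For a lattice $\mathcal{L}$ with minimum $\hat0$ and maximum $\hat1$, $\mathcal{J}$ denotes the set of join-irreducible elements (elements $x\neq\hat0$ not of the form $y\vee z$ with $y,z<x$) and $\mathcal{M}$ the set of meet-irreducible elements (dually; $\hat1\notin\mathcal{M}$). The length of $\mathcal{L}$ is the largest $r$ for which there is a chain $x_0<x_1<\dots<x_r$. $\mathcal{L}$ is extremal if it has length $n$ and $|\mathcal{J}|=|\mathcal{M}|=n$. An element $x$ is left modular if $(y\vee x)\wedge z=y\vee(x\wedge z)$ for all $y\le z$; $\mathcal{L}$ is left modular if it has a maximal chain consisting of left modular elements; $\mathcal{L}$ is trim if it is both extremal and left modular. For a trim lattice of length $n$, fix a chain $\hat0=x_0\lessdot x_1\lessdot\dots\lessdot x_n=\hat1$ of left modular elements of length $n$. For $i\in[n]=\{1,\dots,n\}$, let $j_i$ be the unique join-irreducible with $j_i\le x_i$, $j_i\not\le x_{i-1}$, and $m_i$ the unique meet-irreducible with $m_i\ge x_{i-1}$, $m_i\not\ge x_i$ (so $x_i=j_1\vee\dots\vee j_i=m_{i+1}\wedge\dots\wedge m_n$). The left modular labelling of a cover relation is $\gamma(y\lessdot z)=\min\{i\in[n]: y\vee(x_i\wedge z)=z\}$ (equivalently, the least $i$ with $y\vee j_i=z$, and also the greatest $i$ with $z\wedge m_i=y$); distinct covers incident to the same element receive distinct labels. Downward labels: $\mathrm{D}^\gamma(y)=\{\gamma(x\lessdot y): x\lessdot y\}$; upward labels: $\mathrm{U}^\gamma(y)=\{\gamma(y\lessdot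 z): y\lessdot z\}$. The Galois graph $G(\mathcal{L})$ is the directed graph on $[n]$ with an arrow $i\to k$ iff $i\ne k$ and $j_i\not\le m_k$ (arrows only occur with $i>k$). The Galois poset $P(\mathcal{L})$ is the partial order on $[n]$ with $k\le i$ iff there is a directed path (possibly of length $0$) from $i$ to $k$ in $G(\mathcal{L})$. For $i\in[n]$, $\mathrm{flip}^\gamma_i:\mathcal{L}\to\mathcal{L}$ sends $y$ to the element $x$ with $x\lessdot y$ and $\gamma(x\lessdot y)=i$ if $i\in\mathrm{D}^\gamma(y)$, to the element $z$ with $y\lessdot z$ and $\gamma(y\lessdot z)=i$ if $i\in\mathrm{U}^\gamma(y)$, and fixes $y$ otherwise. *)

(* Defs.v *)
From HB Require Import structures.
From mathcomp Require Import all_boot all_order.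

Set Implicit Arguments.
Unset Strict Implicit.
Unset Printing Implicit Defensive.

Import Order.TTheory.
Local Open Scope order_scope.

Section FiniteLattices.
Context {disp : Order.disp_t} {L : finTBLatticeType disp}.

Definition covers (y z : L) : bool :=
  (y < z) && [forall w : L, ~~ ((y < w) && (w < z))].

Definition is_chain (A : {set L}) : bool :=
  [forall x in A, forall y in A, x >=< y].

Definition is_join_irreducible (x : L) : bool :=
  (x != \bot) &&
  [forall y : L, forall z : L, (y < x) && (z < x) ==> (y `|` z != x)].

Definition is_meet_irreducible (x : L) : bool :=
  (x != \top) &&
  [forall y : L, forall z : L, (x < y) && (x < z) ==> (y `&` z != x)].

Definition left_modular (x : L) : Prop :=
  forall y z : L, y <= z -> (y `|` x) `&` z = y `|` (x `&` z).

End FiniteLattices.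

Section Trim.
Context {disp : Order.disp_t} (L : finTBLatticeType disp).

Definition join_irreducibles : {set L} := [set x | is_join_irreducible x].
Definition meet_irreducibles : {set L} := [set x | is_meet_irreducible x].

(* A chain x_0 < ... < x_r has r + 1 elements, hence the predecessor. *)
Definition lattice_length : nat :=
  (\max_(A : {set L} | is_chain A) #|A|.-1)%N.

Definition extremal_lattice : Prop :=
  #|join_irreducibles| = lattice_length /\
  #|meet_irreducibles| = lattice_length.

Definition left_modular_lattice : Prop :=
  exists A : {set L},
    maxset is_chain A /\ (forall x : L, x \in A -> left_modular x).

Definition trim_lattice : Prop := extremal_lattice /\ left_modular_lattice.

End Trim.

(* An edge labelling with labels in T: [lab y z] is only meaningful when z
   covers y. It is option-valued so that a label given by a minimum over a
   possibly empty set of labels is a total function. *)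
Section EdgeLabellings.
Context {disp : Order.disp_t} {L : finTBLatticeType disp} {T : finType}.
Variable lab : L -> L -> option T.

Definition down_labels (y : L) : {set T} :=
  [set i | [exists x : L, covers x y && (lab x y == Some i)]].

Definition up_labels (y : L) : {set T} :=
  [set i | [exists z : L, covers y z && (lab y z == Some i)]].

Definition descriptive : Prop :=
  [/\ injective down_labels,
      injective up_labels &
      [set down_labels x | x : L] = [set up_labels x | x : L]].

(* When [lab] is descriptive the element picked exists and is unique, so the
   default value x is never used. *)
Definition rowmotion (x : L) : L :=
  odflt x [pick y : L | up_labels y == down_labels x].

Definition flip (i : T) (y : L) : L :=
  if [pick x : L | covers x y && (lab x y == Some i)] is Some x then x
  else if [pick z : L | covers y z && (lab y z == Some i)] is Some z then z
  else y.

End EdgeLabellings.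

(* Labels {1, ..., n} are represented by 'I_n: the ordinal with value k stands
   for the label k + 1. Thus, for the label represented by i, [chain_at x i] is
   x_i and [chain_before x i] is x_{i-1} in the 1-based numbering. *)
Section LeftModularChain.
Context {disp : Order.disp_t} {L : finTBLatticeType disp} {n : nat}.
Variable x : 'I_n.+1 -> L.

Definition chain_at (i : 'I_n) : L := x (lift ord0 i).
Definition chain_before (i : 'I_n) : L := x (widen_ord (leqnSn n) i).

Definition left_modular_chain : Prop :=
  [/\ x ord0 = \bot,
      x ord_max = \top,
      (forall i : 'I_n, covers (chain_before i) (chain_at i)) &
      (forall k : 'I_n.+1, left_modular (x k))].

(* In a trim lattice of length n, exactly one element satisfies the condition
   under each of the next two picks; the defaults are never used. *)
Definition chain_join_irr (i : 'I_n) : L :=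
  odflt \bot [pick j : L | [&& j \in join_irreducibles L,
                              j <= chain_at i & ~~ (j <= chain_before i)]].

Definition chain_meet_irr (i : 'I_n) : L :=
  odflt \top [pick m : L | [&& m \in meet_irreducibles L,
                              chain_before i <= m & ~~ (chain_at i <= m)]].

(* The least i with y \/ (x_i /\ z) = z; for y <= z with y != z it exists, as
   x_n is the maximum. *)
Definition left_modular_labelling (y z : L) : option 'I_n :=
  let P := [pred i : 'I_n | y `|` (chain_at i `&` z) == z] in
  [pick i : 'I_n | P i && [forall k : 'I_n, P k ==> (i <= k)%N]].

Definition galois_arrow : rel 'I_n :=
  fun i k => (i != k) && ~~ (chain_join_irr i <= chain_meet_irr k).

Definition galois_le (k i : 'I_n) : bool := connect galois_arrow i k.

End LeftModularChain.

Definition linear_extension (n : nat) (le : rel 'I_n) (l : n.-tuple 'I_n) :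
    Prop :=
  uniq l /\
  (forall a b : 'I_n, le (tnth l a) (tnth l b) -> (a <= b)%N).

(* Main.v *)
(* A cover y < z has label i exactly when j_i <= z and y <= m_i, and two labels
   going up (or down) from the same element are never joined by an arrow of the
   Galois graph. Consequently, crossing a cover labelled i keeps k among the
   upward labels whenever k is not above i in the Galois poset, and, dually,
   among the downward labels whenever k is not below i. Flipping along a linear
   extension therefore turns the downward labels of the start, one after the
   other, into upward labels of the end without disturbing the others: the
   composite of the flips sends a to an element whose upward labels are the
   downward labels of a. With the injectivity of both label maps this gives
   both parts at once. *)

Require Import Defs.
From mathcomp Require Import all_boot all_order.

Set Implicit Arguments.
Unset Strict Implicit.
Unset Printing Implicit Defensive.

Import Order.TTheory.
Local Open Scope order_scope.

(** * Covers and join-irreducibles in a finite lattice *)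

Section Covers.
Context {disp : Order.disp_t} {L : finTBLatticeType disp}.
Implicit Types y z w : L.

Lemma covers_lt y z : covers y z -> y < z.
Proof. by case/andP. Qed.

Lemma covers_between y z w : covers y z -> y <= w -> w <= z -> w = y \/ w = z.
Proof.
case/andP=> _ /forallP/(_ w) + yw wz; rewrite !lt_neqAle yw wz !andbT.
rewrite negb_and !negbK => /orP[/eqP|/eqP]; by auto.
Qed.

Lemma covers_dual y z : covers (y : L^d) (z : L^d) = covers z y.
Proof. by congr (_ && _); apply: eq_forallb => w; rewrite andbC. Qed.

Lemma minimal_element (P : pred L) y :
  P y -> exists2 c, P c & forall w, w < c -> ~~ P w.
Proof.
move=> Py; have [c Pc cmin] := arg_minnP (fun u => #|[set w | w < u]|) Py.
exists c => // w wc; apply/negP => /cmin; rewrite leqNgt => /negP[].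
apply/proper_card/properP; split.
  by apply/subsetP => t; rewrite !inE => /lt_trans; apply.
by exists w; rewrite !inE ?wc ?ltxx.
Qed.

Lemma covers_above y z : y < z -> exists2 u, covers y u & u <= z.
Proof.
move=> yz; have [|u /andP[yu uz] umin] :=
  @minimal_element (fun u => (y < u) && (u <= z)) z; first by rewrite yz lexx.
exists u => //; rewrite /covers yu /=.
apply/forallP => w; apply/negP => /andP[yw wu].
by have := umin w wu; rewrite yw (le_trans (ltW wu) uz).
Qed.

(** A minimal element below [y] and not below [z] works: everything strictly under it lies below
    [z], and so do joins of such elements. *)
Lemma join_irreducible_between y z :
  ~~ (y <= z) -> exists c, [/\ is_join_irreducible c, c <= y & ~~ (c <= z)].
Proof.
move=> yz; have [|c /andP[cy cz] cmin] :=
  @minimal_element (fun u => (u <= y) && ~~ (u <= z)) y; first by rewrite lexx.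
exists c; split=> //.
have lt_le_z w : w < c -> w <= z.
  by move=> wc; have := cmin w wc; rewrite (le_trans (ltW wc) cy) negbK.
apply/andP; split; first by apply: contraNneq cz => ->; apply: le0x.
apply/forallP => w; apply/forallP => t; apply/implyP => /andP[wc tc].
by apply: contraNneq cz => <-; rewrite leUx !lt_le_z.
Qed.

End Covers.

Lemma covers_below (disp : Order.disp_t) (L : finTBLatticeType disp) (y z : L) :
  y < z -> exists2 u, covers u z & y <= u.
Proof.
move=> yz; have [u zu uy] := @covers_above _ (L^d) z y yz.
by exists u; rewrite // -covers_dual.
Qed.

(** * Moving upward labels across a cover, for abstract [j] and [m] *)

Section LabelledCovers.
Context {disp : Order.disp_t} {L : finTBLatticeType disp} {I : finType}.
Variables j m : I -> L.

(** Self-dual under exchange of [j] and [m], unlike the minimum in [left_modular_labelling]. *)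
Definition edge i (y z : L) := [&& covers y z, j i <= z & y <= m i].

Hypothesis jm : forall i, ~~ (j i <= m i).

Lemma edge_join i y z : edge i y z -> z = y `|` j i.
Proof.
case/and3P=> yz jz ym.
have [|e|-> //] := covers_between yz (leUl y (j i)).
  by rewrite leUx jz ltW ?covers_lt.
by have /negP[] := jm i; rewrite (le_trans _ ym) // -e leUr.
Qed.

Hypothesis edge_ex : forall y z, covers y z -> exists i, edge i y z.
Hypothesis edge_uniq : forall i k y z, edge i y z -> edge k y z -> i = k.
Hypothesis up_independent :
  forall i k y z w, edge i y z -> edge k y w -> i != k -> j k <= m i.

(** Let [l] label a cover [u] of [y] below y \/ j_k. As [u <= m i], [l] differs from [i], so
    independence puts z = y \/ j_i below [m l]. Thus [l] labels the cover from [z] to [v] and equals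
    [k]. *)
Lemma up_label_below i k y z v :
  edge i y z -> j k <= m i -> edge k z v -> exists w, edge k y w.
Proof.
move=> eyz jkm ezv.
have [yz _ ym] := and3P eyz; have [zv jkv zm] := and3P ezv.
have le_yz := ltW (covers_lt yz); have le_zv := ltW (covers_lt zv).
have ylt : y < y `|` j k.
  rewrite lt_neqAle leUl andbT; apply/eqP => e; have /negP[] := jm k.
  by rewrite (le_trans _ (le_trans le_yz zm)) // e leUr.
have [u yu uw] := covers_above ylt.
have [l eyu] := edge_ex yu; have [_ jlu yml] := and3P eyu.
have um : u <= m i by rewrite (le_trans uw) // leUx ym.
have neq_il : i != l.
  by apply/eqP => e; have /negP[] := jm l; rewrite (le_trans jlu) // -e.
have zml : z <= m l.
  by rewrite (edge_join eyz) leUx yml (up_independent eyu eyz) // eq_sym.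
have uv : u <= v by rewrite (le_trans uw) // leUx (le_trans le_yz).
have ezl : edge l z v by rewrite /edge zv zml (le_trans jlu).
by exists u; rewrite (edge_uniq ezv ezl).
Qed.

(* The hypothesis on [l] cannot be dropped: in the pentagon with long chain
   0 < x_1 < x_2 < 1, the bottom has upward labels 1 and 3 and x_1 only 2. *)
Lemma up_label_above i k y z w :
    edge i y z -> j k <= m i -> (forall l, (j k <= m l) || (j l <= m i)) ->
  edge k y w -> exists v, edge k z v.
Proof.
move=> eyz jkm nopath eyw.
have [yz jiz ym] := and3P eyz; have [yw jkw ymk] := and3P eyw.
have zlt : z < z `|` w.
  rewrite lt_neqAle leUl andbT; apply/eqP => e.
  have wz : w <= z by rewrite e leUr.
  have [wy|wz'] := covers_between yz (ltW (covers_lt yw)) wz.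
    by have := covers_lt yw; rewrite wy ltxx.
  have /negP[] := jm i.
  by rewrite -{1}(edge_uniq eyw (_ : edge i y w)) // /edge yw ym wz' jiz.
have [u zu uv] := covers_above zlt.
have [l ezu] := edge_ex zu; have [_ jlu zml] := and3P ezu.
have [<-|neq_lk] := eqVneq l k; first by exists u.
(* Otherwise [m l] would be above [z] and w = y \/ j_k, hence above [j l]. *)
have njkl : ~~ (j k <= m l).
  apply/negP => jkl; have /negP[] := jm l.
  rewrite (le_trans jlu) // (le_trans uv) // leUx zml (edge_join eyw) leUx jkl.
  by rewrite (le_trans (ltW (covers_lt yz))).
have := nopath l; rewrite (negPf njkl) /= => jli.
(* Now [l] is also an upward label of [y], and its independence from [k] contradicts [njkl]. *)
have [t eyt] := up_label_below eyz jli ezu.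
by have := up_independent eyt eyw neq_lk; rewrite (negPf njkl).
Qed.

End LabelledCovers.

(** * Join-irreducibles along the left modular chain *)

Section LeftModularChainTheory.
Context {disp : Order.disp_t} {L : finTBLatticeType disp} {n : nat}.
Variable x : 'I_n.+1 -> L.
Hypothesis hx : left_modular_chain x.

Local Notation at_ := (chain_at x).
Local Notation before := (chain_before x).

Lemma chain_step (P : pred L) :
  P \bot -> ~~ P \top -> exists2 p, P (before p) & ~~ P (at_ p).
Proof.
case: hx => x0 x1 _ _ P0 P1.
have [/existsP[p /andP[]]|/existsPn none] :=
  boolP [exists p, P (before p) && ~~ P (at_ p)]; first by exists p.
suff all_P (k : 'I_n.+1) : P (x k) by move: P1; rewrite -x1 all_P.
case: k => k; elim: k => [|k IH] lt_kn.
  by rewrite (_ : Ordinal _ = ord0) ?x0 //; apply: val_inj.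
have := none (Ordinal (lt_kn : (k < n)%N)).
rewrite negb_and negbK /chain_before /chain_at.
rewrite (_ : lift _ _ = Ordinal lt_kn); last exact: val_inj.
rewrite (_ : widen_ord _ _ = Ordinal (ltnW lt_kn)); last exact: val_inj.
by rewrite IH.
Qed.

Lemma chain_le (k l : 'I_n.+1) : (k <= l)%N -> x k <= x l.
Proof.
case: hx => _ _ cov _; case: l => l; elim: l => [|l IH] lt_ln le_kl.
  rewrite (_ : k = Ordinal lt_ln) //; apply: val_inj.
  by move: le_kl; rewrite leqn0 => /eqP.
move: le_kl; rewrite leq_eqVlt => /orP[/eqP e|le_kl].
  by rewrite (_ : k = Ordinal lt_ln) //; apply: val_inj.
apply: le_trans (IH (ltnW lt_ln) le_kl) _.
have /covers_lt/ltW := cov (Ordinal (lt_ln : (l < n)%N)).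
rewrite /chain_before /chain_at.
rewrite (_ : lift _ _ = Ordinal lt_ln); last exact: val_inj.
by rewrite (_ : widen_ord _ _ = Ordinal (ltnW lt_ln)) //; apply: val_inj.
Qed.

Lemma at_le_before (p q : 'I_n) : (p < q)%N -> at_ p <= before q.
Proof. by move=> pq; apply: chain_le; rewrite lift0. Qed.

Lemma chain_join_irrP i :
  [/\ is_join_irreducible (chain_join_irr x i), chain_join_irr x i <= at_ i &
      ~~ (chain_join_irr x i <= before i)].
Proof.
rewrite /chain_join_irr; case: pickP => [c /and3P[]|none]; first by rewrite inE.
have nle : ~~ (at_ i <= before i).
  by rewrite lt_geF //; apply: covers_lt; case: hx.
have [c [cJ ca cb]] := join_irreducible_between nle.
by have := none c; rewrite inE cJ ca cb.
Qed.

Lemma chain_slot_inj (c : L) (i k : 'I_n) :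
  c <= at_ i -> ~~ (c <= before i) -> c <= at_ k -> ~~ (c <= before k) -> i = k.
Proof.
move=> ci nci ck nck; apply: val_inj; case: (ltngtP i k) => // lt.
  by rewrite (le_trans ci) ?at_le_before in nck.
by rewrite (le_trans ck) ?at_le_before in nci.
Qed.

(* The [n] elements j_i are distinct, so a lattice with only [n]
   join-irreducibles has no others. *)
Lemma chain_join_irr_le (i : 'I_n) (a : L) : #|join_irreducibles L| = n ->
  a <= at_ i -> ~~ (a <= before i) -> chain_join_irr x i <= a.
Proof.
move=> cardJ ai nai; have [c [cJ ca nc]] := join_irreducible_between nai.
have imJ : [set chain_join_irr x k | k : 'I_n] = join_irreducibles L.
  apply/eqP; rewrite eqEcard; apply/andP; split.
    by apply/subsetP => _ /imsetP[k _ ->]; rewrite inE; have [] := chain_join_irrP k.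
  rewrite cardJ card_imset ?card_ord // => k l e.
  have [_ k1 k2] := chain_join_irrP k; have [_ l1 l2] := chain_join_irrP l.
  by apply: (@chain_slot_inj (chain_join_irr x k)); rewrite // e.
have : c \in join_irreducibles L by rewrite inE.
rewrite -imJ => /imsetP[k _ ck].
have [_ k1 k2] := chain_join_irrP k; rewrite -ck in k1 k2.
by rewrite (@chain_slot_inj c i k) // -?ck // (le_trans ca).
Qed.

End LeftModularChainTheory.

(** * The reversed chain in the dual lattice *)

Section DualChain.
Context {disp : Order.disp_t} {L : finTBLatticeType disp} {n : nat}.
Variable x : 'I_n.+1 -> L.

(** Label [i] becomes [rev_ord i] and j, m trade places, so facts on m are facts on j read in
    [L^d]. *)
Definition dual_chain : 'I_n.+1 -> L^d := fun k => x (rev_ord k).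

Lemma chain_at_dual i : chain_at dual_chain i = chain_before x (rev_ord i).
Proof. by congr x; apply: val_inj; rewrite /= !subSS. Qed.

Lemma chain_before_dual i : chain_before dual_chain i = chain_at x (rev_ord i).
Proof.
by congr x; apply: val_inj; rewrite /= /bump /= add1n subSS subnSK.
Qed.

Lemma left_modular_chain_dual :
  left_modular_chain x -> left_modular_chain dual_chain.
Proof.
case=> x0 x1 cov lm; split.
- by apply: etrans x1; congr x; apply: val_inj; rewrite /= subn1.
- by apply: etrans x0; congr x; apply: val_inj; rewrite /= subnn.
- by move=> i; rewrite chain_at_dual chain_before_dual covers_dual.
(* The dual identity is the original with [y] and [z] exchanged, read backwards. *)
- move=> k y z yz; have := lm (rev_ord k) z y yz.
  rewrite (@meetC _ L) (@joinC _ L z) [RHS](@joinC _ L) (@meetC _ L _ y).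
  exact: esym.
Qed.

Lemma chain_join_irr_dual i :
  chain_join_irr dual_chain i = chain_meet_irr x (rev_ord i).
Proof.
congr odflt; apply: eq_pick => c.
by rewrite /= chain_at_dual chain_before_dual.
Qed.

Lemma chain_meet_irr_dual i :
  chain_meet_irr dual_chain i = chain_join_irr x (rev_ord i).
Proof.
congr odflt; apply: eq_pick => c.
by rewrite /= chain_at_dual chain_before_dual.
Qed.

End DualChain.

(** * Labels of covers in a trim lattice *)

Section TrimChain.
Context {disp : Order.disp_t} {L : finTBLatticeType disp} {n : nat}.
Variable x : 'I_n.+1 -> L.
Hypothesis hx : left_modular_chain x.
Hypothesis cardJ : #|join_irreducibles L| = n.
Hypothesis cardM : #|meet_irreducibles L| = n.

Local Notation at_ := (chain_at x).
Local Notation before := (chain_before x).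
Local Notation j := (chain_join_irr x).
Local Notation m := (chain_meet_irr x).

Lemma chain_meet_irrP i : before i <= m i /\ ~~ (at_ i <= m i).
Proof.
have [_] := chain_join_irrP (left_modular_chain_dual hx) (rev_ord i).
by rewrite chain_at_dual chain_before_dual chain_join_irr_dual rev_ordK.
Qed.

Lemma chain_meet_irr_ge i a : before i <= a -> ~~ (at_ i <= a) -> a <= m i.
Proof.
move=> ai nai.
have := @chain_join_irr_le _ _ _ _ (left_modular_chain_dual hx) (rev_ord i) a.
rewrite chain_at_dual chain_before_dual chain_join_irr_dual rev_ordK.
by apply.
Qed.

(** The cover forces x_{i-1} \/ j_i = x_i, so j_i <= m_i would give x_i <= m_i. *)
Lemma join_meet_irr i : ~~ (j i <= m i).
Proof.
have [_ ja jb] := chain_join_irrP hx i; have [bm am] := chain_meet_irrP i.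
have cov : covers (before i) (at_ i) by case: hx.
apply: contraNN am => jm; have ba := ltW (covers_lt cov).
have [|e|<-] := covers_between cov (leUl (before i) (j i)).
- by rewrite leUx ba.
- by rewrite -e leUr in jb.
- by rewrite leUx bm.
Qed.

(** The chain separates them: j_i <= x_i <= x_{k-1} <= m_k. Hence Galois arrows only go to smaller
    labels. *)
Lemma join_le_meet (i k : 'I_n) : (i < k)%N -> j i <= m k.
Proof.
move=> ik; have [_ ja _] := chain_join_irrP hx i.
have [bm _] := chain_meet_irrP k.
by rewrite (le_trans ja) // (le_trans (at_le_before hx ik)).
Qed.

(** Left modularity gives (y \/ x_{p-1}) /\ z = y, so x_p is not below y \/ x_{p-1}, which then lies
    below m_p. *)
Lemma chain_meet_irr_crossing p y z : y <= z ->
  before p `&` z <= y -> ~~ (at_ p `&` z <= y) -> y <= m p.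
Proof.
move=> yz bp ap; have [_ _ _ lm] := hx.
have e : (y `|` before p) `&` z = y.
  by rewrite (lm _ y z yz); apply/eqP; rewrite eq_joinl.
apply: le_trans (leUl y (before p)) _; apply: chain_meet_irr_ge.
  exact: leUr.
by apply: contraNN ap => le; rewrite -[X in _ <= X]e leI2.
Qed.

(** At [p], x_p /\ z stops lying below [y]; not being below x_{p-1}, it is above j_p. Intervals are
    arbitrary because [edge_up_independent] takes w < z \/ w. *)
Lemma chain_crossing y z : y < z ->
  exists p, [/\ before p `&` z <= y, j p <= z & y <= m p].
Proof.
move=> yz; have [||p bp ap] := @chain_step _ _ _ _ hx (fun c => c `&` z <= y).
- by rewrite meet0x le0x.
- by rewrite meet1x lt_geF.
exists p; split=> //; last by apply: chain_meet_irr_crossing ap; rewrite // ltW.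
apply: le_trans (leIr z (at_ p)).
apply: (chain_join_irr_le hx cardJ); first exact: leIl.
by apply: contraNN ap => le; rewrite (le_trans _ bp) // lexI le leIr.
Qed.

(* Any other label [k] is excluded: if [p < k] then [j p <= m k], and if
   [k < p] then [j k] already lies below [before p]. *)
Lemma edge_crossing y z : covers y z ->
  exists2 p, before p `&` z <= y & forall k, edge j m k y z = (k == p).
Proof.
move=> cyz; have [p [bp jp ym]] := chain_crossing (covers_lt cyz).
have ep : edge j m p y z by rewrite /edge cyz jp.
exists p => // k; apply/idP/eqP => [ek|-> //].
have [_ jk yk] := and3P ek; apply: val_inj; case: (ltngtP k p) => // lt.
- have [_ jak _] := chain_join_irrP hx k.
  have /negP[] := join_meet_irr k; apply: le_trans yk; apply: le_trans bp.
  by rewrite lexI jk (le_trans jak) // at_le_before.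
- have /negP[] := join_meet_irr k; apply: le_trans jk _.
  by rewrite (edge_join join_meet_irr ep) leUx yk join_le_meet.
Qed.

(** The minimum is the crossing index [p]: for q < p, x_q /\ z <= x_{p-1} /\ z <= y adds nothing to
    [y], while x_p /\ z is above j_p and y \/ j_p = z. *)
Lemma left_modular_labellingE i y z : covers y z ->
  (left_modular_labelling x y z == Some i) = edge j m i y z.
Proof.
move=> cyz; have [p bp edgeE] := edge_crossing cyz; rewrite edgeE.
have /and3P[_ jp _] : edge j m p y z by rewrite edgeE.
have labp : y `|` (at_ p `&` z) == z.
  have [_ jat _] := chain_join_irrP hx p.
  rewrite eq_le leUx leIr (ltW (covers_lt cyz)) /=.
  rewrite [X in X <= _](edge_join join_meet_irr (y := y) (i := p)) ?edgeE //.
  by rewrite leU2 // lexI jat.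
rewrite /left_modular_labelling; case: pickP => [q|none].
  move=> /andP[/= /eqP yq /forallP/(_ p)]; rewrite labp /= => qp.
  suff -> : q = p by rewrite eq_sym.
  apply: val_inj; apply/eqP; rewrite eqn_leq qp leqNgt; apply/negP => lt.
  have := covers_lt cyz; rewrite -yq (_ : _ `|` _ = y) ?ltxx //.
  apply/eqP; rewrite eq_joinl; apply: le_trans bp.
  by rewrite leI2 // at_le_before.
have /= := none p; rewrite labp /= => /negbT/forallPn[q].
rewrite negb_imply -ltnNge => /andP[/eqP yq lt].
have := covers_lt cyz; rewrite -yq (_ : _ `|` _ = y) ?ltxx //.
apply/eqP; rewrite eq_joinl; apply: le_trans bp.
by rewrite leI2 // at_le_before.
Qed.

Lemma edge_exists y z : covers y z -> exists i, edge j m i y z.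
Proof. by case/edge_crossing => p _ edgeE; exists p; rewrite edgeE. Qed.

Lemma edge_unique i k y z : edge j m i y z -> edge j m k y z -> i = k.
Proof.
move=> ei ek; have [cyz _ _] := and3P ei; have [p _ edgeE] := edge_crossing cyz.
by move: ei ek; rewrite !edgeE => /eqP-> /eqP->.
Qed.

(** Only [i < k] needs work: the crossing index [p] of w < z \/ w turns out to be [i], and j_k <= w
    <= m_p. *)
Lemma edge_up_independent i k y z w :
  edge j m i y z -> edge j m k y w -> i != k -> j k <= m i.
Proof.
move=> eyz eyw neq_ik; have := neq_ik.
rewrite -val_eqE neq_ltn => /orP[] lt; last exact: join_le_meet.
have [cyz jiz ymi] := and3P eyz; have [cyw jkw ymk] := and3P eyw.
have [p' bp' edgeE'] := edge_crossing cyw.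
have bz : before i `&` z <= y.
  by have [p bp edgeE] := edge_crossing cyz; move: eyz; rewrite edgeE => /eqP->.
have {p' bp' edgeE'} bw : before k `&` w <= y.
  by move: eyw; rewrite edgeE' => /eqP->.
have ley_z := ltW (covers_lt cyz); have ley_w := ltW (covers_lt cyw).
have nji : ~~ (j i <= y).
  by apply: contraNN (join_meet_irr i) => /le_trans; apply.
have njiw : ~~ (j i <= w).
  apply: contraNN nji => le; apply: le_trans bw; rewrite lexI le andbT.
  by have [_ ja _] := chain_join_irrP hx i; rewrite (le_trans ja) ?at_le_before.
have wlt : w < z `|` w.
  rewrite lt_neqAle leUr andbT; apply: contraNneq njiw => ->.
  by rewrite lexU2 ?jiz.
have [p [bp jp wm]] := chain_crossing wlt.
have [_ jiat _] := chain_join_irrP hx i; have [_ jpat _] := chain_join_irrP hx p.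
case: (ltngtP p i) => [pi|ip|/val_inj<-]; last exact: le_trans wm.
(* If [p < i], then z < z \/ w also crosses at [p], so z \/ w <= m_p, against j_p <= z \/ w. *)
- have zm : z <= m p.
    apply: (chain_meet_irr_crossing (z := z `|` w)); first exact: leUl.
      apply: le_trans ley_z; apply: le_trans bw; rewrite lexI bp andbT.
      rewrite (le_trans (leIl _ _)) // (chain_le hx) //=.
      exact: ltnW (ltn_trans pi lt).
    apply: contraNN (join_meet_irr p) => le; apply: le_trans wm.
    apply: le_trans ley_w; apply: le_trans bz; rewrite lexI.
    rewrite (le_trans jpat (at_le_before hx pi)) (le_trans _ le) //.
    by rewrite lexI jpat.
  by have := join_meet_irr p; rewrite (le_trans jp) // leUx zm.
(* If [i < p], then j_i <= x_{p-1} /\ (z \/ w) <= w. *)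
- have /negP[] := njiw; apply: le_trans bp.
  by rewrite lexI (le_trans jiat (at_le_before hx ip)) lexU2 ?jiz.
Qed.

End TrimChain.

(** * Duality for labelled covers *)

Section EdgeDual.
Context {disp : Order.disp_t} {L : finTBLatticeType disp}.

Lemma edge_dual (I : finType) (j m : I -> L) i (y z : L) :
  edge (m : I -> L^d) (j : I -> L^d) i (y : L^d) (z : L^d) = edge j m i z y.
Proof. by rewrite /edge covers_dual; congr (_ && _); rewrite andbC. Qed.

Lemma edge_dual_chain (n : nat) (x : 'I_n.+1 -> L) i (y z : L) :
  edge (chain_join_irr (dual_chain x)) (chain_meet_irr (dual_chain x))
    i (y : L^d) (z : L^d) =
  edge (chain_join_irr x) (chain_meet_irr x) (rev_ord i) z y.
Proof.
by rewrite -edge_dual /edge chain_join_irr_dual chain_meet_irr_dual.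
Qed.

Lemma edge_meet (I : finType) (j m : I -> L) i (y z : L) :
  (forall i, ~~ (j i <= m i)) -> edge j m i y z -> y = z `&` m i.
Proof.
by move=> jm; rewrite -edge_dual; apply: (@edge_join _ L^d I m j jm i z y).
Qed.

End EdgeDual.

(** * Labels of neighbours and the Galois graph *)

Section TrimLabels.
Context {disp : Order.disp_t} {L : finTBLatticeType disp} {n : nat}.
Variable x : 'I_n.+1 -> L.
Hypothesis hx : left_modular_chain x.
Hypothesis cardJ : #|join_irreducibles L| = n.
Hypothesis cardM : #|meet_irreducibles L| = n.

Local Notation j := (chain_join_irr x).
Local Notation m := (chain_meet_irr x).
Local Notation gamma := (left_modular_labelling x).
Local Notation U := (up_labels gamma).
Local Notation D := (down_labels gamma).

Let jm := join_meet_irr hx.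
Let edge_ex := edge_exists hx cardJ cardM.
Let edge_un := @edge_unique _ _ _ _ hx cardJ cardM.
Let edge_up_ind := @edge_up_independent _ _ _ _ hx cardJ cardM.
Let labE := @left_modular_labellingE _ _ _ _ hx cardJ cardM.

Lemma edge_down_independent i k y z w :
  edge j m i z y -> edge j m k w y -> i != k -> j i <= m k.
Proof.
move=> ezy ewy neq_ik.
have := @edge_up_independent _ _ _ _ (left_modular_chain_dual hx) cardM cardJ
  (rev_ord i) (rev_ord k) y z w.
rewrite !edge_dual_chain !rev_ordK (inj_eq rev_ord_inj).
rewrite chain_join_irr_dual chain_meet_irr_dual !rev_ordK.
exact.
Qed.

Lemma up_labelsP k y : reflect (exists z, edge j m k y z) (k \in U y).
Proof.
rewrite inE; apply: (iffP existsP) => -[z].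
  by case/andP=> cyz; rewrite labE // => e; exists z.
by move=> e; have [cyz _ _] := and3P e; exists z; rewrite labE ?cyz.
Qed.

Lemma down_labelsP k y : reflect (exists z, edge j m k z y) (k \in D y).
Proof.
rewrite inE; apply: (iffP existsP) => -[z].
  by case/andP=> cyz; rewrite labE // => e; exists z.
by move=> e; have [cyz _ _] := and3P e; exists z; rewrite labE ?cyz.
Qed.

(** Excluding paths of length at most two suffices; length 0 handles [k = i]. *)
Lemma no_galois_path k i : ~~ connect (galois_arrow x) k i ->
  j k <= m i /\ forall l, (j k <= m l) || (j l <= m i).
Proof.
move=> nki.
have jkm : j k <= m i.
  apply: contraNT nki => njk; have [->|neq] := eqVneq k i; first exact: connect0.
  by rewrite connect1 // /galois_arrow neq.
split=> // l; apply: contraNT nki; rewrite negb_or => /andP[nkl nli].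
have neq_kl : k != l by apply: contraNneq nli => <-.
have neq_li : l != i by apply: contraNneq nkl => ->.
by apply: (@connect_trans _ _ l); rewrite connect1 // /galois_arrow ?neq_kl ?neq_li.
Qed.

Lemma up_labels_edge i k y z : edge j m i y z ->
  ~~ connect (galois_arrow x) k i -> (k \in U y) = (k \in U z).
Proof.
move=> e /no_galois_path[jkm nopath].
apply/up_labelsP/up_labelsP => -[w ew].
  exact: (up_label_above jm edge_ex edge_un edge_up_ind e jkm nopath ew).
exact: (up_label_below jm edge_ex edge_un edge_up_ind e jkm ew).
Qed.

(** In [L^d], with [j] and [m] exchanged and labels kept, arrows are reversed and the upward lemmas
    apply. *)
Lemma down_labels_edge i k y z : edge j m i y z ->
  ~~ connect (galois_arrow x) i k -> (k \in D y) = (k \in D z).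
Proof.
move=> e /no_galois_path[jim nopath].
have e' : edge (m : _ -> L^d) (j : _ -> L^d) i (z : L^d) y by rewrite edge_dual.
have ex' (a b : L^d) : covers a b ->
    exists l, edge (m : _ -> L^d) (j : _ -> L^d) l a b.
  by rewrite covers_dual => /edge_ex[l el]; exists l; rewrite edge_dual.
have un' p q (a b : L^d) : edge (m : _ -> L^d) (j : _ -> L^d) p a b ->
    edge (m : _ -> L^d) (j : _ -> L^d) q a b -> p = q.
  by rewrite !edge_dual; apply: edge_un.
have ind' p q (a b c : L^d) : edge (m : _ -> L^d) (j : _ -> L^d) p a b ->
    edge (m : _ -> L^d) (j : _ -> L^d) q a c -> p != q ->
    (m q : L^d) <= (j p : L^d).
  by rewrite !edge_dual; apply: edge_down_independent.
apply/down_labelsP/down_labelsP => -[w]; rewrite -edge_dual => ew.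
  have [v] := @up_label_below _ L^d _ m j jm ex' un' ind' _ _ _ _ _ e' jim ew.
  by rewrite edge_dual; exists v.
have nopath' l : ((m k : L^d) <= j l) || ((m l : L^d) <= j i).
  by rewrite orbC; apply: nopath.
have [v] := @up_label_above _ L^d _ m j jm ex' un' ind' _ _ _ _ _ e' jim nopath' ew.
by rewrite edge_dual; exists v.
Qed.

(** * Flips and slow motion *)

Lemma up_down_labels_disjoint i y : i \in U y -> i \notin D y.
Proof.
case/up_labelsP => z /and3P[_ _ ym]; apply/down_labelsP => -[w /and3P[_ jy _]].
by have := jm i; rewrite (le_trans jy).
Qed.

(** Each pick has one candidate, since y = z /\ m_i and z = y \/ j_i. *)
Lemma edge_flip i y z :
  edge j m i y z -> flip gamma i z = y /\ flip gamma i y = z.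
Proof.
move=> e; have [cyz _ _] := and3P e; split; rewrite /flip.
  case: pickP => [w|/(_ y)]; last by rewrite cyz labE // e.
  case/andP=> cwz; rewrite labE // => ew.
  by rewrite (edge_meet jm ew) (edge_meet jm e).
case: pickP => [w /andP[cwy]|_].
  rewrite labE // => /and3P[_ jy _]; have [_ _ ym] := and3P e.
  by have := jm i; rewrite (le_trans jy).
case: pickP => [w|/(_ z)]; last by rewrite cyz labE // e.
case/andP=> cyw; rewrite labE // => ew.
by rewrite (edge_join jm ew) (edge_join jm e).
Qed.

Lemma flip_fix i y : i \notin D y -> i \notin U y -> flip gamma i y = y.
Proof.
rewrite /flip => nD nU; case: pickP => [w wP|_].
  by case/negP: nD; rewrite inE; apply/existsP; exists w.
case: pickP => // w wP.
by case/negP: nU; rewrite inE; apply/existsP; exists w.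
Qed.

Lemma flip_labels i k y :
  [/\ (i \in U (flip gamma i y)) = (i \in D y),
      ~~ connect (galois_arrow x) k i ->
        (k \in U (flip gamma i y)) = (k \in U y) &
      ~~ connect (galois_arrow x) i k ->
        (k \in D (flip gamma i y)) = (k \in D y)].
Proof.
have [iD|niD] := boolP (i \in D y).
  have /down_labelsP[z e] := iD; have [-> _] := edge_flip e; split.
  - by apply/up_labelsP; exists y.
  - exact: up_labels_edge.
  - exact: down_labels_edge.
have [iU|niU] := boolP (i \in U y); last by rewrite flip_fix ?(negPf niU).
have /up_labelsP[z e] := iU; have [_ ->] := edge_flip e; split.
- apply/negbTE; apply: contraTN (_ : i \in D z) => [/up_down_labels_disjoint //|].
  by apply/down_labelsP; exists y.
- by move=> nki; rewrite (up_labels_edge e).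
- by move=> nik; rewrite (down_labels_edge e).
Qed.

(* After flipping the labels in [s], the upward labels in [s] and the downward
   labels outside [s] together are the downward labels of the start. *)
Lemma up_labels_foldl_flip (s t : seq 'I_n) (a b : L) :
    s ++ t =i 'I_n ->
    pairwise (fun i k => ~~ connect (galois_arrow x) i k) (s ++ t) ->
    {in s, forall k, (k \in U b) = (k \in D a)} ->
    {in t, forall k, (k \in D b) = (k \in D a)} ->
  U (foldl (fun c i => flip gamma i c) b t) = D a.
Proof.
elim: t s b => [|i t IH] s b.
  by rewrite cats0 => full _ Us _; apply/setP => k; apply: Us; rewrite full.
rewrite -cat_rcons => full ps Us Dt /=.
have := ps; rewrite cat_rcons pairwise_cat => /and3P[/allrelP st _ /=].
case/andP=> /allP it _; apply: IH full ps _ _ => k.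
  rewrite mem_rcons inE => /orP[/eqP->|ks].
    by have [-> _ _] := flip_labels i i b; apply: Dt; rewrite mem_head.
  (* Earlier labels have no path to [i], so they stay upward. *)
  have [_ keepU _] := flip_labels i k b.
  by rewrite keepU ?Us // st ?mem_head.
(* [i] has no path to later labels, so their downward status is kept. *)
move=> kt; have [_ _ keepD] := flip_labels i k b.
by rewrite keepD ?Dt ?it // inE kt orbT.
Qed.

Lemma up_labels_slow_motion (l : n.-tuple 'I_n) (a : L) :
  linear_extension (galois_le x) l ->
  U (foldl (fun b i => flip gamma i b) a l) = D a.
Proof.
case=> ul ext; apply: (@up_labels_foldl_flip [::]) => //=.
  apply/subset_cardP; rewrite ?subset_predT //.
  by rewrite (card_uniqP ul) size_tuple card_ord.
rewrite -[tval l](map_tnth_enum l) pairwise_map.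
apply: (sub_pairwise (r := fun p q : 'I_n => (p < q)%N)) => [p q|].
  (* A path from entry [p] to entry [q] puts the latter lower in the Galois poset, forcing
     [q <= p]. *)
  by rewrite ltnNge; apply: contra; apply: ext.
rewrite -(pairwise_map val ltn) val_enum_ord.
by rewrite -(sorted_pairwise ltn_trans) iota_ltn_sorted.
Qed.

(** * Injectivity of the label maps *)

Lemma le_of_down_labels y z : {subset D y <= D z} -> y <= z.
Proof.
move=> sub; apply: contraT => nle.
have lt : y `&` z < y by rewrite lt_neqAle leIl andbT eq_meetl.
(* If [i] were in [D z], then j_i <= y /\ z <= c <= m_i. *)
have [c cy le_c] := covers_below lt; have [i e] := edge_ex cy.
have /sub/down_labelsP[w /and3P[_ jz _]] : i \in D y.
  by apply/down_labelsP; exists c.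
have [_ jy cm] := and3P e; have /negP[] := jm i.
by rewrite (le_trans _ cm) // (le_trans _ le_c) // lexI jy.
Qed.

Lemma le_of_up_labels y z : {subset U y <= U z} -> z <= y.
Proof.
move=> sub; apply: contraT => nle.
have lt : y < y `|` z by rewrite lt_neqAle leUl andbT eq_sym eq_joinl.
have [c yc c_le] := covers_above lt; have [i e] := edge_ex yc.
have /sub/up_labelsP[w /and3P[_ _ zm]] : i \in U y.
  by apply/up_labelsP; exists c.
have [_ jc ym] := and3P e; have /negP[] := jm i.
by rewrite (le_trans jc) // (le_trans c_le) // leUx ym.
Qed.

Lemma down_labels_inj : injective D.
Proof.
by move=> y z e; apply/eqP; rewrite eq_le !le_of_down_labels ?e // -e.
Qed.

Lemma up_labels_inj : injective U.
Proof.
by move=> y z e; apply/eqP; rewrite eq_le !le_of_up_labels ?e // -e.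
Qed.

(** Supplies an extension for the claims that mention none. *)
Lemma linear_extension_ord : linear_extension (galois_le x) (ord_tuple n).
Proof.
split; first exact: enum_uniq.
move=> a b; rewrite !tnth_ord_tuple /galois_le => /connectP[p].
elim: p b => [|c p IH] b /=; first by move=> _ ->.
case/andP=> /andP[neq nle] pp e; apply: leq_trans (IH c pp e) _.
by rewrite leqNgt; apply: contraNN nle => lt; apply: join_le_meet; rewrite // ltnW.
Qed.

End TrimLabels.

Theorem theorem1p3 (disp : Order.disp_t) (L : finTBLatticeType disp) (n : nat)
    (x : 'I_n.+1 -> L)
    (hlen : lattice_length L = n)
    (htrim : trim_lattice L)
    (hx : left_modular_chain x) :
  let gamma := left_modular_labelling x in
  (descriptive gamma /\
   (forall a : L, exists! b : L, up_labels gamma b = down_labels gamma a)) /\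
  (forall l : n.-tuple 'I_n, linear_extension (galois_le x) l ->
   forall a : L,
     rowmotion gamma a = foldl (fun b i => flip gamma i b) a l).
Proof.
case: htrim => -[]; rewrite hlen => cardJ cardM _ gamma.
have injU : injective (up_labels gamma) := up_labels_inj hx cardJ cardM.
have injD : injective (down_labels gamma) := down_labels_inj hx cardJ cardM.
have UD l a : linear_extension (galois_le x) l ->
    up_labels gamma (foldl (fun b i => flip gamma i b) a l) = down_labels gamma a.
  exact: up_labels_slow_motion.
have ext := linear_extension_ord hx.
split; first split; first split => //.
(* One inclusion suffices: by injectivity both images have the size of [L]. *)
- apply/eqP; rewrite eqEcard !card_imset // leqnn andbT.
  by apply/subsetP => _ /imsetP[a _ ->]; rewrite -(UD _ a ext) imset_f.
- move=> a; eexists; split; first exact: UD ext.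
  by move=> b; rewrite -(UD _ a ext) => /injU.
move=> l ext_l a; rewrite /rowmotion; case: pickP => [b /eqP|none].
  by rewrite -(UD l a ext_l) => /injU.
(* The composite of the flips is a candidate, so the default is never reached. *)
by have := none (foldl (fun b i => flip gamma i b) a l); rewrite UD ?eqxx.
Qed.
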